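(* Let $R$ be a unitary ring and let $a,b,d\in R$ be such that $b$ is an outer inverse of $a$. Then the following statements are equivalent. (i) $b$ is the inverse of $a$ along $d$. (ii) $Rd=Rb$, $bR\subseteq dR$ and $b_{-1}(0)\subseteq d_{-1}(0)$. (iii) $bR=dR$, $Rb\subseteq Rd$ and $b^{-1}(0)\subseteq d^{-1}(0)$. (iv) $Rb\subseteq Rd$, $bR\subseteq dR$, $b_{-1}(0)\subseteq d_{-1}(0)$ and $b^{-1}(0)\subseteq d^{-1}(0)$.
   Context: $R$ is an associative ring with unit $1$. For $c\in R$: $cR=\{cx: x\in R\}$, $Rc=\{xc: x\in R\}$, $c^{-1}(0)=\{x\in R: cx=0\}$, $c_{-1}(0)=\{x\in R: xc=0\}$. An element $b$ is an outer inverse of $a$ if $b=bab$. An element $a$ is invertible along $d$ if there is $b\in R$ with $b=bab$, $bR=dR$ and $Rb=Rd$; such $b$ is unique and is called the inverse of $a$ along $d$. *)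

(* Defs.v *)
From HB Require Import structures.
From mathcomp Require Import all_boot all_order all_algebra.
From mathcomp Require Import boolp classical_sets.

Set Implicit Arguments.
Unset Strict Implicit.
Unset Printing Implicit Defensive.

Import GRing.Theory.

Local Open Scope classical_set_scope.
Local Open Scope ring_scope.

Section InverseAlong.
Variable R : pzRingType.
Implicit Types a b c d : R.

(* cR *)
Definition rideal c : set R := [set c * x | x in [set: R]].

(* Rc *)
Definition lideal c : set R := [set x * c | x in [set: R]].

(* c^{-1}(0) *)
Definition rann c : set R := [set x | c * x = 0].

(* c_{-1}(0) *)
Definition lann c : set R := [set x | x * c = 0].

Definition outer_inverse a b : Prop := b = b * a * b.

Definition inverse_along a d b : Prop :=
  [/\ b = b * a * b, rideal b = rideal d & lideal b = lideal d].

Lemma inverse_along_uniq a d b b' :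
  inverse_along a d b -> inverse_along a d b' -> b = b'.
Proof.
move=> [hb rb lb] [hb' rb' lb'].
have [x _ hx] : rideal b b' by rewrite rb -rb'; exists 1; rewrite ?mulr1.
have [y _ hy] : lideal b' b by rewrite lb' -lb; exists 1; rewrite ?mul1r.
transitivity (b * a * b'); last by rewrite -hx mulrA -hb.
by rewrite -[in RHS]hy -!mulrA [b' * _]mulrA -hb' hy.
Qed.

End InverseAlong.

(* Main.v *)
Require Import Defs.
From mathcomp Require Import all_boot all_order all_algebra.
From mathcomp Require Import boolp classical_sets.

Import GRing.Theory.

Local Open Scope classical_set_scope.
Local Open Scope ring_scope.

(** An inclusion of principal one-sided ideals always reverses the inclusion of
    the annihilators on the other side: if [d] is a right multiple of [b], then
    whatever kills [b] from the left kills [d].  When [b = b * a * b], this can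
    be undone.  The element [1 - b * a] kills [b] from the left, so if it also
    kills [d], then [d = b * (a * d)] is a right multiple of [b]; dually
    [1 - a * b] handles left multiples.  Hence, for an outer inverse [b], the
    inclusion [lann b `<=` lann d] is [rideal d `<=` rideal b] in disguise and
    [rann b `<=` rann d] is [lideal d `<=` lideal b] ([lann_sub_rideal] and
    [rann_sub_lideal]).  After this translation the four conditions all say that
    [b] and [d] generate the same right ideal and the same left ideal. *)

Lemma rideal_sub_lann (R : pzRingType) (b d : R) :
  rideal d `<=` rideal b -> lann b `<=` lann d.
Proof.
move=> db x /= xb0.
have [y _ <-] : rideal b d by apply: db; exists 1; rewrite ?mulr1.
by rewrite /lann /= mulrA xb0 mul0r.
Qed.

Lemma lideal_sub_rann (R : pzRingType) (b d : R) :
  lideal d `<=` lideal b -> rann b `<=` rann d.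
Proof.
move=> db x /= bx0.
have [y _ <-] : lideal b d by apply: db; exists 1; rewrite ?mul1r.
by rewrite /rann /= -mulrA bx0 mulr0.
Qed.

(** The element [1 - b * a] of [lann b] witnesses that [d = b * (a * d)]. *)
Lemma lann_sub_rideal (R : pzRingType) (a b d : R) :
  outer_inverse a b -> (lann b `<=` lann d) <-> (rideal d `<=` rideal b).
Proof.
move=> hb; split=> [bd _ [x _ <-]|]; last exact: rideal_sub_lann.
have /bd/= : lann b (1 - b * a) by rewrite /lann /= mulrBl mul1r -hb subrr.
rewrite /lann /= mulrBl mul1r => /subr0_eq dE.
by exists (a * d * x) => //; rewrite !mulrA -dE.
Qed.

(** The element [1 - a * b] of [rann b] witnesses that [d = d * a * b]. *)
Lemma rann_sub_lideal (R : pzRingType) (a b d : R) :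
  outer_inverse a b -> (rann b `<=` rann d) <-> (lideal d `<=` lideal b).
Proof.
move=> hb; split=> [bd _ [x _ <-]|]; last exact: lideal_sub_rann.
have /bd/= : rann b (1 - a * b).
  by rewrite /rann /= mulrBr mulr1 mulrA -hb subrr.
rewrite /rann /= mulrBr mulr1 => /subr0_eq dE.
by exists (x * d * a) => //; rewrite -!mulrA -dE.
Qed.

Theorem theorem3p2 (R : pzRingType) (a b d : R) (hb : outer_inverse a b) :
  [<-> (* i *) inverse_along a d b;
       (* ii *) [/\ lideal d = lideal b, rideal b `<=` rideal d
                  & lann b `<=` lann d];
       (* iii *) [/\ rideal b = rideal d, lideal b `<=` lideal d
                   & rann b `<=` rann d];
       (* iv *) [/\ lideal b `<=` lideal d, rideal b `<=` rideal d,
                    lann b `<=` lann d & rann b `<=` rann d]].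
Proof.
have lannE := lann_sub_rideal R a b d hb.
have rannE := rann_sub_lideal R a b d hb.
tfae.
- by move=> [_ rE lE]; split; rewrite ?lE ?rE //; apply/lannE; rewrite rE.
- move=> [lE rbd /lannE rdb]; split; first exact/seteqP.
    by rewrite lE.
  by apply/rannE; rewrite lE.
- move=> [rE lbd rann_bd]; split=> //; first by rewrite rE.
  by apply/lannE; rewrite rE.
- by move=> [lbd rbd /lannE rdb /rannE ldb]; split=> //; apply/seteqP.
Qed.
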